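(* Let $k\ge1$. There is a representation (monoid homomorphism) $\mathscr B_k^+(\mathbb T_0)\to\mathbb A_{q,t}[q^{1/2}]$ (with values in the loops at the vertex $k$, the identity going to $e_k$) given by sending $T_i$ to $q^{-1/2}T_i$, $y_i$ to $-y_i$ and $z_i$ to $(qt)^{-1}z_i$.
   Context: **The monoid.** For $k\ge1$, $\mathscr B_k^+(\mathbb T_0)$ is the monoid generated by $T_i,T_i^{-1}$ ($1\le i\le k-1$), $y_1,z_1$ subject to the following relations, where $y_{i+1}=T_i^{-1}y_iT_i^{-1}$, $z_{i+1}=T_iz_iT_i$ ($1\le i\le k-1$): $T_iT_i^{-1}=T_i^{-1}T_i=1$; $T_iT_{i+1}T_i=T_{i+1}T_iT_{i+1}$; $T_iT_j=T_jT_i$ ($|i-j|>1$); $y_iT_j=T_jy_i$, $z_iT_j=T_jz_i$ ($i\notin\{j,j+1\}$); $y_iy_j=y_jy_i$, $z_iz_j=z_jz_i$; and, if $k>1$, $z_1T_1y_1T_1^{-1}=T_1^{-1}y_1T_1^{-1}z_1$. For $k=1$ it is the free monoid on $y_1,z_1$. **The algebras.** Put $T_{k\searrow1}=T_{k-1}\cdots T_1$ and $T^*_{k\searrow1}=T_{k-1}^{-1}\cdots T_1^{-1}$. The Dyck path algebra $\mathbb A_q$ is the path algebra of the quiver with vertex set $\mathbb Z_{\ge0}$, arrows $d_+:k\to k+1$, $d_-:k+1\to k$, loops $T_1,\dots,T_{k-1}$ at $k$, subject to the relations below (products are composed right to left and $k$ is the vertex where the paths begin): $(T_i-1)(T_i+q)=0$,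 $T_iT_{i+1}T_i=T_{i+1}T_iT_{i+1}$, $T_iT_j=T_jT_i$ ($|i-j|>1$); $d_-^2T_{k-1}=d_-^2$, $T_id_-=d_-T_i$ ($1\le i\le k-2$); $T_1d_+^2=d_+^2$, $d_+T_i=T_{i+1}d_+$ ($1\le i\le k-1$); $d_-(d_+d_--d_-d_+)T_{k-1}=q(d_+d_--d_-d_+)d_-$ ($k\ge2$); $T_1(d_+d_--d_-d_+)d_+=q\,d_+(d_+d_--d_-d_+)$ ($k\ge1$). The idempotent at the vertex $k$ is $e_k$. $\mathbb A_{q,t}$ is the path algebra over $\mathbb Q(q,t)$ of the quiver with vertex set $\mathbb Z_{\ge0}$, arrows $d_+,d_+^*:k\to k+1$, $d_-:k+1\to k$, loops $T_1,\dots,T_{k-1}$ at $k$, subject to: (1) the relations of $\mathbb A_q$ for $T_i,d_-,d_+$; (2) the relations of $\mathbb A_{q^{-1}}$ (replace $q$ by $q^{-1}$) for $T_i^{-1},d_-,d_+^*$; (3) for all $k\ge0$, on paths starting at $k$: $d_+z_i=z_{i+1}d_+$, $d_+^*y_i=y_{i+1}d_+^*$ ($1\le i\le k$), $z_1d_+=-tq^{k+1}y_1d_+^*$. Here the loops $y_i,z_i$ at the vertex $k$ are $y_1=\frac1{q^{k-1}(q-1)}(d_+d_--d_-d_+)T_{k\searrow1}$, $y_{i+1}=qT_i^{-1}y_iT_i^{-1}$, $z_1=\frac{q^k}{1-q}(d_+^*d_--d_-d_+^* )T^*_{k\searrow1}$, $z_{i+1}=q^{-1}T_iz_iT_i$.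 $\mathbb A_{q,t}[q^{1/2}]$ is obtained by adjoining $q^{1/2}$ to the scalars. *)

(* Defs.v *)
From HB Require Import structures.
From mathcomp Require Import all_boot all_order all_algebra generic_quotient.
From mathcomp Require Import boolp finmap.
From mathcomp.multinomials Require Import monalg.

Set Implicit Arguments.
Unset Strict Implicit.
Unset Printing Implicit Defensive.

Import GRing.Theory.

Local Open Scope fset_scope.
Local Open Scope ring_scope.
Local Open Scope quotient_scope.

(* Path algebras have no unit when there are infinitely many vertices, so they
   are modules that are also semigroups (boot/monoid.v) for the product. *)
Notation "x ** y" := (@monoid.mul _ x%R y%R)
  (at level 40, left associativity) : ring_scope.

Section PresentedMonoid.
Variables (G : choiceType) (rel : seq G -> seq G -> Prop).

Inductive word_cong : seq G -> seq G -> Prop :=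
| word_cong_rel u v : rel u v -> word_cong u v
| word_cong_refl u : word_cong u u
| word_cong_sym u v : word_cong u v -> word_cong v u
| word_cong_trans v u w : word_cong u v -> word_cong v w -> word_cong u w
| word_cong_cat u u' v v' :
    word_cong u u' -> word_cong v v' -> word_cong (u ++ v) (u' ++ v').

Definition word_congb (u v : seq G) : bool := `[< word_cong u v >].

Fact word_congb_equiv : equiv_class_of word_congb.
Proof.
split=> [u|u v|v u w].
- exact/asboolP/word_cong_refl.
- by apply/asboolP/asboolP; apply: word_cong_sym.
- by move=> /asboolP uv /asboolP vw; apply/asboolP/(word_cong_trans uv vw).
Qed.
Canonical word_congb_equivRel := EquivRelPack word_congb_equiv.

Definition presented_monoid := {eq_quot word_congb}.
HB.instance Definition _ : EqQuotient _ word_congb presented_monoid :=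
  EqQuotient.on presented_monoid.
HB.instance Definition _ := Choice.on presented_monoid.

Implicit Types x y z : presented_monoid.

Definition word_class : seq G -> presented_monoid := \pi_presented_monoid.

Lemma word_classP u v : word_class u = word_class v <-> word_cong u v.
Proof.
by split=> [/eqP|uv]; [rewrite eqmodE => /asboolP | apply/eqP; rewrite eqmodE; apply/asboolP].
Qed.

Definition pm_mul x y : presented_monoid := word_class (repr x ++ repr y).

Lemma word_class_repr x : word_class (repr x) = x.
Proof. exact: reprK. Qed.

Lemma pm_mul_class u v :
  pm_mul (word_class u) (word_class v) = word_class (u ++ v).
Proof.
by apply/word_classP/word_cong_cat; apply/word_classP/word_class_repr.
Qed.

Fact pm_mulA : associative pm_mul.
Proof.
move=> x y z; rewrite -[x]word_class_repr -[y]word_class_repr.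
by rewrite -[z]word_class_repr !pm_mul_class catA.
Qed.
Fact pm_mul1 : left_id (word_class [::]) pm_mul.
Proof. by move=> x; rewrite -[x]word_class_repr pm_mul_class. Qed.
Fact pm_mulr1 : right_id (word_class [::]) pm_mul.
Proof. by move=> x; rewrite -[x]word_class_repr pm_mul_class cats0. Qed.

HB.instance Definition _ :=
  isMonoid.Build presented_monoid pm_mulA pm_mul1 pm_mulr1.

End PresentedMonoid.

Section Bplus.
Variable k : nat.

Inductive bgen : Type :=
| GenT i of (0 < i < k)%N
| GenTinv i of (0 < i < k)%N
| Geny1
| Genz1.

HB.instance Definition _ := gen_eqMixin bgen.
HB.instance Definition _ := gen_choiceMixin bgen.

(* T_i and T_i^-1; the empty word when i is not in {1, ..., k-1} *)
Definition wT (i : nat) : seq bgen :=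
  if decP (@idP (0 < i < k)%N) is left h then [:: GenT h] else [::].
Definition wTinv (i : nat) : seq bgen :=
  if decP (@idP (0 < i < k)%N) is left h then [:: GenTinv h] else [::].

(* indices start at 1; the value at 0 is not used *)
Fixpoint wy (i : nat) : seq bgen :=
  if i is (_.+1 as j).+1 then wTinv j ++ wy j ++ wTinv j else [:: Geny1].
Fixpoint wz (i : nat) : seq bgen :=
  if i is (_.+1 as j).+1 then wT j ++ wz j ++ wT j else [:: Genz1].

Variant Bplus_rel : seq bgen -> seq bgen -> Prop :=
| B_TV i of (0 < i < k)%N : Bplus_rel (wT i ++ wTinv i) [::]
| B_VT i of (0 < i < k)%N : Bplus_rel (wTinv i ++ wT i) [::]
| B_braid i of (0 < i)%N & (i.+1 < k)%N :
    Bplus_rel (wT i ++ wT i.+1 ++ wT i) (wT i.+1 ++ wT i ++ wT i.+1)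
| B_far i j of (0 < i < k)%N & (0 < j < k)%N & (i.+1 < j)%N || (j.+1 < i)%N :
    Bplus_rel (wT i ++ wT j) (wT j ++ wT i)
| B_yT i j of (0 < i <= k)%N & (0 < j < k)%N & i != j & i != j.+1 :
    Bplus_rel (wy i ++ wT j) (wT j ++ wy i)
| B_zT i j of (0 < i <= k)%N & (0 < j < k)%N & i != j & i != j.+1 :
    Bplus_rel (wz i ++ wT j) (wT j ++ wz i)
| B_yy i j of (0 < i <= k)%N & (0 < j <= k)%N :
    Bplus_rel (wy i ++ wy j) (wy j ++ wy i)
| B_zz i j of (0 < i <= k)%N & (0 < j <= k)%N :
    Bplus_rel (wz i ++ wz j) (wz j ++ wz i)
| B_zy of (1 < k)%N :
    Bplus_rel (wz 1 ++ wT 1 ++ wy 1 ++ wTinv 1)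
              (wTinv 1 ++ wy 1 ++ wTinv 1 ++ wz 1).

Definition Bplus := presented_monoid Bplus_rel.
HB.instance Definition _ := Monoid.on Bplus.

Definition BT (i : nat) : Bplus := word_class _ (wT i).
Definition BTinv (i : nat) : Bplus := word_class _ (wTinv i).
Definition By (i : nat) : Bplus := word_class _ (wy i).
Definition Bz (i : nat) : Bplus := word_class _ (wz i).

End Bplus.

Record quiver := Quiver {
  vertex : choiceType;
  arrow : choiceType;
  source : arrow -> vertex;
  target : arrow -> vertex }.

Section Paths.
Variable Q : quiver.

(* Paths compose right to left: (v, [:: a_n; ..; a_1]) starts at v, follows
   a_1 first and a_n last; (v, [::]) is the path of length 0 at v. *)
Definition seq_end (v : vertex Q) (s : seq (arrow Q)) : vertex Q :=
  if s is a :: _ then target a else v.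

Fixpoint is_path (v : vertex Q) (s : seq (arrow Q)) : bool :=
  if s is a :: s' then (source a == seq_end v s') && is_path v s' else true.

Record qpath := QPath {
  path_val : vertex Q * seq (arrow Q);
  _ : is_path path_val.1 path_val.2 }.
HB.instance Definition _ := [isSub for path_val].
HB.instance Definition _ := [Choice of qpath by <:].

Definition path_start (p : qpath) : vertex Q := (val p).1.
Definition path_end (p : qpath) : vertex Q := seq_end (val p).1 (val p).2.

Lemma seq_end_cat v s1 s2 : seq_end v (s1 ++ s2) = seq_end (seq_end v s2) s1.
Proof. by case: s1. Qed.

Lemma is_path_cat v s1 s2 :
  is_path v (s1 ++ s2) = is_path (seq_end v s2) s1 && is_path v s2.
Proof. by elim: s1 => //= a s1 ->; rewrite seq_end_cat andbA. Qed.

(* p after r, defined when p starts where r ends *)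
Definition path_comp (p r : qpath) : option qpath :=
  if path_start p == path_end r
  then insub (path_start r, (val p).2 ++ (val r).2) else None.

Lemma path_compP (p r : qpath) : path_start p = path_end r ->
  exists2 u, path_comp p r = Some u &
    val u = (path_start r, (val p).2 ++ (val r).2).
Proof.
move=> pr; rewrite /path_comp pr eqxx.
have ok : is_path (path_start r) ((val p).2 ++ (val r).2).
  by rewrite is_path_cat -[seq_end _ _]pr (valP p) (valP r).
by exists (@QPath (path_start r, (val p).2 ++ (val r).2) ok); rewrite ?(@insubT _ (fun w => is_path w.1 w.2) _ (path_start r, _) ok).
Qed.

Lemma path_compN (p r : qpath) :
  path_start p != path_end r -> path_comp p r = None.
Proof. by rewrite /path_comp => /negPf->. Qed.

Lemma path_compA (p r s : qpath) :
  obind (path_comp^~ s) (path_comp p r) = obind (path_comp p) (path_comp r s).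
Proof.
have [pr|npr] := eqVneq (path_start p) (path_end r); last first.
  rewrite (path_compN npr) /=.
  have [rs|/path_compN->//] := eqVneq (path_start r) (path_end s).
  have [u -> uE] /= := path_compP rs.
  rewrite path_compN //; apply: contraNneq npr => ->.
  by rewrite /path_end uE /= seq_end_cat -[seq_end (path_start s) _]rs.
have [u -> uE] /= := path_compP pr.
have us : path_start u = path_start r by rewrite /path_start uE.
have [rs|nrs] := eqVneq (path_start r) (path_end s); last first.
  by rewrite (path_compN nrs) path_compN // us.
have [v -> vE] /= := path_compP rs.
have pv : path_start p = path_end v.
  by rewrite pr /path_end vE /= seq_end_cat -[seq_end (path_start s) _]rs.
have [w -> wE] := path_compP pv.
have [|w' -> w'E] := @path_compP u s; first by rewrite us.
congr Some; apply: val_inj; rewrite wE w'E uE vE /= catA.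
by rewrite /path_start vE.
Qed.

Definition vertex_path (v : vertex Q) : qpath :=
  @QPath (v, [::]) isT.

Fact arrow_path_subproof (a : arrow Q) : is_path (source a) [:: a].
Proof. by rewrite /= eqxx. Qed.
Definition arrow_path (a : arrow Q) : qpath :=
  @QPath (source a, [:: a]) (arrow_path_subproof a).

End Paths.

Section PathAlgebra.
Variables (R : comNzRingType) (Q : quiver).

Definition path_algebra := {malg R[qpath Q]}.
HB.instance Definition _ := GRing.Lmodule.on path_algebra.

Implicit Types (x y z : path_algebra) (p r s : qpath Q) (c : R).

Definition pa_term c p r : path_algebra :=
  if path_comp p r is Some u then << c *g u >> else 0.

Definition pa_mul x y : path_algebra :=
  \sum_(p <- msupp x) \sum_(r <- msupp y) pa_term (x@_p * y@_r) p r.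

Lemma pa_term0 p r : pa_term 0 p r = 0.
Proof. by rewrite /pa_term; case: path_comp => // u; rewrite monalgU0. Qed.

Lemma pa_termD c1 c2 p r :
  pa_term (c1 + c2) p r = pa_term c1 p r + pa_term c2 p r.
Proof.
by rewrite /pa_term; case: path_comp => [u|]; rewrite ?addr0 ?monalgUD.
Qed.

Lemma monalgUZ c c' p : c *: << c' *g p >> = << c * c' *g p >> :> path_algebra.
Proof. by apply/malgP => s; rewrite mcoeffZ !mcoeffU mulrnAr. Qed.

Lemma pa_termZ c c' p r : pa_term (c * c') p r = c *: pa_term c' p r.
Proof.
by rewrite /pa_term; case: path_comp => [u|]; rewrite ?scaler0 ?monalgUZ.
Qed.

Lemma pa_mulw (dx dy : {fset qpath Q}) x y :
  msupp x `<=` dx -> msupp y `<=` dy ->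
  pa_mul x y = \sum_(p <- dx) \sum_(r <- dy) pa_term (x@_p * y@_r) p r.
Proof.
move=> lex ley; rewrite /pa_mul (big_fset_incl _ lex) /=; last first.
  move=> p _ /mcoeff_outdom xp; rewrite big1 // => r _.
  by rewrite xp mul0r pa_term0.
apply/eq_bigr=> p _; apply/big_fset_incl => // r _ /mcoeff_outdom ->.
by rewrite mulr0 pa_term0.
Qed.

Fact pa_mulDl : left_distributive pa_mul +%R.
Proof.
move=> x y z; pose d := msupp x `|` msupp y.
rewrite (@pa_mulw d (msupp z)) ?msuppD_le //.
rewrite (@pa_mulw d (msupp z) x) ?fsubsetUl //.
rewrite (@pa_mulw d (msupp z) y) ?fsubsetUr //.
rewrite -big_split; apply/eq_bigr => p _; rewrite -big_split; apply/eq_bigr=> r _.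
by rewrite mcoeffD mulrDl pa_termD.
Qed.

Fact pa_mulDr : right_distributive pa_mul +%R.
Proof.
move=> z x y; pose d := msupp x `|` msupp y.
rewrite (@pa_mulw (msupp z) d) ?msuppD_le //.
rewrite (@pa_mulw (msupp z) d _ x) ?fsubsetUl //.
rewrite (@pa_mulw (msupp z) d _ y) ?fsubsetUr //.
rewrite -big_split; apply/eq_bigr => p _; rewrite -big_split; apply/eq_bigr=> r _.
by rewrite mcoeffD mulrDr pa_termD.
Qed.

Fact pa_mul0l : left_zero 0 pa_mul.
Proof. by move=> x; rewrite /pa_mul msupp0 big_seq_fset0. Qed.
Fact pa_mul0r : right_zero 0 pa_mul.
Proof.
by move=> x; rewrite /pa_mul msupp0 big1 // => p _; rewrite big_seq_fset0.
Qed.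

Fact pa_mulZl c x y : pa_mul (c *: x) y = c *: pa_mul x y.
Proof.
rewrite (@pa_mulw (msupp x) (msupp y)) ?msuppZ_le ?fsubset_refl // scaler_sumr.
apply/eq_bigr => p _; rewrite scaler_sumr; apply/eq_bigr => r _.
by rewrite mcoeffZ -mulrA (pa_termZ c).
Qed.

Fact pa_mulZr c x y : pa_mul x (c *: y) = c *: pa_mul x y.
Proof.
rewrite (@pa_mulw (msupp x) (msupp y)) ?msuppZ_le ?fsubset_refl // scaler_sumr.
apply/eq_bigr => p _; rewrite scaler_sumr; apply/eq_bigr => r _.
by rewrite mcoeffZ mulrCA (pa_termZ c).
Qed.

Lemma pa_mulUU c c' p r : pa_mul << c *g p >> << c' *g r >> = pa_term (c * c') p r.
Proof.
by rewrite (pa_mulw msuppU_le msuppU_le) !big_seq_fset1 !mcoeffUU.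
Qed.

Lemma pa_mul_suml I (s : seq I) (F : I -> path_algebra) y :
  pa_mul (\sum_(i <- s) F i) y = \sum_(i <- s) pa_mul (F i) y.
Proof.
exact: (big_morph (pa_mul^~ y) (fun _ _ => pa_mulDl _ _ _) (pa_mul0l y)).
Qed.
Lemma pa_mul_sumr I (s : seq I) (F : I -> path_algebra) y :
  pa_mul y (\sum_(i <- s) F i) = \sum_(i <- s) pa_mul y (F i).
Proof.
exact: (big_morph (pa_mul y) (fun _ _ => pa_mulDr _ _ _) (pa_mul0r y)).
Qed.

Fact pa_mulA : associative pa_mul.
Proof.
move=> x y z; rewrite [x]monalgE (pa_mul_suml _ _ y).
rewrite (pa_mul_suml _ _ z) (pa_mul_suml _ _ (pa_mul y z)).
apply/eq_bigr => p _; move EX: << _ *g p >> => X.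
rewrite [y]monalgE (pa_mul_suml _ _ z) (pa_mul_sumr _ _ X).
rewrite (pa_mul_sumr _ _ X) (pa_mul_suml _ _ z).
apply/eq_bigr => r _; move EY: << _ *g r >> => Y.
rewrite [z]monalgE (pa_mul_sumr _ _ Y) (pa_mul_sumr _ _ X).
rewrite (pa_mul_sumr _ _ (pa_mul X Y)); apply/eq_bigr => s _; rewrite -EX -EY.
rewrite !pa_mulUU /pa_term; have := path_compA p r s.
case prE: (path_comp p r) => [u|]; case rsE: (path_comp r s) => [v|] /=.
- by rewrite !pa_mulUU /pa_term mulrA => ->.
- by rewrite pa_mul0r pa_mulUU /pa_term => ->.
- by rewrite pa_mul0l pa_mulUU /pa_term => <-.
- by rewrite pa_mul0l pa_mul0r.
Qed.

HB.instance Definition _ := isSemigroup.Build path_algebra pa_mulA.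

Definition idem (v : vertex Q) : path_algebra := << vertex_path v >>.
Definition arr (a : arrow Q) : path_algebra := << arrow_path a >>.

Lemma idem_mul (v w : vertex Q) :
  idem v ** idem w = if v == w then idem v else 0.
Proof.
rewrite [LHS]pa_mulUU /pa_term mulr1; have [<-|vw] := eqVneq.
  have [u -> uE] := @path_compP Q (vertex_path v) (vertex_path v) erefl.
  by congr << _ >>; apply: val_inj; rewrite uE.
by rewrite path_compN.
Qed.

Lemma arr_idem (a : arrow Q) : arr a ** idem (source a) = arr a.
Proof.
rewrite [LHS]pa_mulUU /pa_term mulr1.
have [u -> uE] := @path_compP Q (arrow_path a) (vertex_path (source a)) erefl.
by congr << _ >>; apply: val_inj; rewrite uE.
Qed.

Lemma idem_arr (a : arrow Q) : idem (target a) ** arr a = arr a.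
Proof.
rewrite [LHS]pa_mulUU /pa_term mulr1.
have [u -> uE] := @path_compP Q (vertex_path (target a)) (arrow_path a) erefl.
by congr << _ >>; apply: val_inj; rewrite uE.
Qed.

Section Relations.
Variable rel : path_algebra -> path_algebra -> Prop.

(* the two-sided ideal generated by the x - y with rel x y *)
Inductive rel_ideal : path_algebra -> Prop :=
| rel_ideal_rel x y : rel x y -> rel_ideal (x - y)
| rel_ideal0 : rel_ideal 0
| rel_idealD x y : rel_ideal x -> rel_ideal y -> rel_ideal (x + y)
| rel_idealZ c x : rel_ideal x -> rel_ideal (c *: x)
| rel_idealMl a x : rel_ideal x -> rel_ideal (a ** x)
| rel_idealMr a x : rel_ideal x -> rel_ideal (x ** a).

Definition rel_ideal_pred : {pred path_algebra} :=
  fun x => `[< rel_ideal x >].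

Fact rel_ideal_zmod_closed : zmod_closed rel_ideal_pred.
Proof.
split=> [|x y /asboolP xI /asboolP yI]; first exact/asboolP/rel_ideal0.
by apply/asboolP/rel_idealD; rewrite // -scaleN1r; apply: rel_idealZ.
Qed.
HB.instance Definition _ :=
  GRing.isZmodClosed.Build path_algebra rel_ideal_pred rel_ideal_zmod_closed.

Definition path_quot := Quotient.quot rel_ideal_pred.
HB.instance Definition _ : EqQuotient _ (Quotient.equiv rel_ideal_pred) path_quot :=
  EqQuotient.on path_quot.
HB.instance Definition _ := GRing.Zmodule.on path_quot.

Definition pq_class : path_algebra -> path_quot := \pi_path_quot.

Lemma class_eq x y : pq_class x = pq_class y <-> rel_ideal (x - y).
Proof.
split=> [/eqP|xy]; first by rewrite -Quotient.idealrBE => /asboolP.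
by apply/eqP; rewrite -Quotient.idealrBE; apply/asboolP.
Qed.

Lemma class_rel x y : rel x y -> pq_class x = pq_class y.
Proof. by move=> xy; apply/class_eq/rel_ideal_rel. Qed.

Lemma reprP_class (x : path_quot) : pq_class (repr x) = x.
Proof. exact: reprK. Qed.

Lemma classD : {morph pq_class : x y / x + y}.
Proof. by move=> x y; rewrite /pq_class !piE. Qed.
Lemma classN : {morph pq_class : x / - x}.
Proof. by move=> x; rewrite /pq_class !piE. Qed.
Lemma class0 : pq_class 0 = 0.
Proof. by rewrite /pq_class !piE. Qed.
Lemma classB : {morph pq_class : x y / x - y}.
Proof. by move=> x y; rewrite classD classN. Qed.

Definition pq_scale c (x : path_quot) : path_quot := pq_class (c *: repr x).
Definition pq_mul (x y : path_quot) : path_quot := pq_class (repr x ** repr y).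

Lemma pq_scale_class c x : pq_scale c (pq_class x) = pq_class (c *: x).
Proof.
apply/class_eq; rewrite -scalerBr; apply/rel_idealZ/class_eq.
exact: reprP_class.
Qed.

Lemma pq_mul_class x y : pq_mul (pq_class x) (pq_class y) = pq_class (x ** y).
Proof.
apply/class_eq; set x' := repr _; set y' := repr _.
have -> : x' ** y' - x ** y = (x' - x) ** y' + x ** (y' - y).
  rewrite [(x' - x) ** y']pa_mulDl [x ** (y' - y)]pa_mulDr.
  rewrite -[- x]scaleN1r -[- y]scaleN1r pa_mulZl pa_mulZr !scaleN1r.
  by rewrite addrA subrK.
by apply: rel_idealD; [apply: rel_idealMr | apply: rel_idealMl];
  apply/class_eq/reprP_class.
Qed.

Fact pq_scaleA c d (x : path_quot) : pq_scale c (pq_scale d x) = pq_scale (c * d) x.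
Proof. by rewrite -[x]reprP_class !pq_scale_class scalerA. Qed.
Fact pq_scale1 : left_id 1 pq_scale.
Proof. by move=> x; rewrite -[x]reprP_class !pq_scale_class scale1r. Qed.
Fact pq_scaleDr : right_distributive pq_scale +%R.
Proof.
move=> c x y; rewrite -[x]reprP_class -[y]reprP_class.
by rewrite -classD !pq_scale_class scalerDr classD.
Qed.
Fact pq_scaleDl (x : path_quot) : {morph pq_scale^~ x : c d / c + d}.
Proof.
by move=> c d; rewrite -[x]reprP_class !pq_scale_class scalerDl classD.
Qed.
HB.instance Definition _ := GRing.Zmodule_isLmodule.Build R path_quot
  pq_scaleA pq_scale1 pq_scaleDr pq_scaleDl.

Fact pq_mulA : associative pq_mul.
Proof.
move=> x y z; rewrite -[x]reprP_class -[y]reprP_class -[z]reprP_class.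
by rewrite !pq_mul_class; congr pq_class; apply: pa_mulA.
Qed.
HB.instance Definition _ := isSemigroup.Build path_quot pq_mulA.

Lemma classZ c x : pq_class (c *: x) = c *: pq_class x.
Proof. by rewrite [RHS]pq_scale_class. Qed.
Lemma classM x y : pq_class (x ** y) = pq_class x ** pq_class y.
Proof. by rewrite [RHS]pq_mul_class. Qed.

Lemma pq_mulDl (x y z : path_quot) : (x + y) ** z = x ** z + y ** z.
Proof.
rewrite -[x]reprP_class -[y]reprP_class -[z]reprP_class.
by rewrite -classD -!classM -classD; congr pq_class; apply: pa_mulDl.
Qed.
Lemma pq_mulDr (x y z : path_quot) : x ** (y + z) = x ** y + x ** z.
Proof.
rewrite -[x]reprP_class -[y]reprP_class -[z]reprP_class.
by rewrite -classD -!classM -classD; congr pq_class; apply: pa_mulDr.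
Qed.
Lemma pq_mulZl c (x y : path_quot) : (c *: x) ** y = c *: (x ** y).
Proof.
rewrite -[x]reprP_class -[y]reprP_class.
by rewrite -classZ -!classM -classZ; congr pq_class; apply: pa_mulZl.
Qed.
Lemma pq_mulZr c (x y : path_quot) : x ** (c *: y) = c *: (x ** y).
Proof.
rewrite -[x]reprP_class -[y]reprP_class.
by rewrite -classZ -!classM -classZ; congr pq_class; apply: pa_mulZr.
Qed.

(* e_v A e_v, a monoid with identity e_v *)
Section Loops.
Variable v : vertex Q.

Local Notation e := (pq_class (idem v)).

Lemma class_idem : e ** e = e.
Proof. by rewrite -classM idem_mul eqxx. Qed.

Record loop := Loop { loop_val :> path_quot; _ : e ** loop_val ** e == loop_val }.
HB.instance Definition _ := [isSub for loop_val].
HB.instance Definition _ := [Choice of loop by <:].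

Lemma loop_el (x : loop) : e ** loop_val x = loop_val x.
Proof. by case: x => x /= /eqP <-; rewrite !mulgA class_idem. Qed.
Lemma loop_er (x : loop) : loop_val x ** e = loop_val x.
Proof. by case: x => x /= /eqP <-; rewrite -!mulgA class_idem. Qed.

Fact loop_one_subproof : e ** e ** e == e.
Proof. by rewrite !class_idem. Qed.
Definition loop_one := Loop loop_one_subproof.

Fact loop_mul_subproof (x y : loop) :
  e ** (loop_val x ** loop_val y) ** e == loop_val x ** loop_val y.
Proof. by rewrite mulgA loop_el -mulgA loop_er. Qed.
Definition loop_mul (x y : loop) : loop := Loop (loop_mul_subproof x y).

Fact loop_mulA : associative loop_mul.
Proof. by move=> x y z; apply: val_inj; rewrite /= mulgA. Qed.
Fact loop_mul1 : left_id loop_one loop_mul.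
Proof. by move=> x; apply: val_inj; rewrite /= loop_el. Qed.
Fact loop_mulr1 : right_id loop_one loop_mul.
Proof. by move=> x; apply: val_inj; rewrite /= loop_er. Qed.
HB.instance Definition _ := isMonoid.Build loop loop_mulA loop_mul1 loop_mulr1.

End Loops.
End Relations.
End PathAlgebra.

Inductive dyck_arrow : Type :=
| ArrDplus of nat
| ArrDplusStar of nat
| ArrDminus of nat
| ArrT k i of (0 < i < k)%N.

HB.instance Definition _ := gen_eqMixin dyck_arrow.
HB.instance Definition _ := gen_choiceMixin dyck_arrow.

Definition dyck_source (a : dyck_arrow) : nat :=
  match a with
  | ArrDplus k => k | ArrDplusStar k => k | ArrDminus k => k.+1
  | @ArrT k _ _ => k
  end.
Definition dyck_target (a : dyck_arrow) : nat :=
  match a with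
  | ArrDplus k => k.+1 | ArrDplusStar k => k.+1 | ArrDminus k => k
  | @ArrT k _ _ => k
  end.
Definition dyck_quiver := @Quiver nat dyck_arrow dyck_source dyck_target.

Section DoubleDyck.
Variables (R : comUnitRingType) (q t : R).

Local Notation P := (path_algebra R dyck_quiver).

(* In all that follows the first index k is the vertex where paths begin. *)
Definition pe (k : nat) : P := @idem R dyck_quiver k.
Definition pdp (k : nat) : P := @arr R dyck_quiver (ArrDplus k).
Definition pds (k : nat) : P := @arr R dyck_quiver (ArrDplusStar k).
(* no arrow d_- begins at 0 *)
Definition pdm (k : nat) : P :=
  if k is j.+1 then @arr R dyck_quiver (ArrDminus j) else 0.
(* there is no loop T_i at k unless 1 <= i <= k-1 *)
Definition pT (k i : nat) : P :=
  if decP (@idP (0 < i < k)%N) is left h then @arr R dyck_quiver (ArrT h) else 0.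

(* (T - 1)(T + q) = 0 means that T (T + q - 1) = q; see [aT_inv]. *)
Definition pTinv (k i : nat) : P := q^-1 *: (pT k i + (q - 1) *: pe k).

Section Dyck.
(* d stands for d_+ or d_+^*, and X for the T_i or the T_i^-1 *)
Variables (u : R) (X : nat -> nat -> P) (d : nat -> P).

Definition pcomm (k : nat) : P := d k.-1 ** pdm k - pdm k.+1 ** d k.

Variant dyck_rel : P -> P -> Prop :=
| D_quad k i of (0 < i < k)%N :
    dyck_rel ((X k i - pe k) ** (X k i + u *: pe k)) 0
| D_braid k i of (0 < i)%N & (i.+1 < k)%N :
    dyck_rel (X k i ** X k i.+1 ** X k i) (X k i.+1 ** X k i ** X k i.+1)
| D_far k i j of (0 < i < k)%N & (0 < j < k)%N
               & (i.+1 < j)%N || (j.+1 < i)%N :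
    dyck_rel (X k i ** X k j) (X k j ** X k i)
| D_mmT k of (2 <= k)%N :
    dyck_rel (pdm k.-1 ** pdm k ** X k k.-1) (pdm k.-1 ** pdm k)
| D_Tm k i of (1 <= i)%N & (i <= k - 2)%N :
    dyck_rel (X k.-1 i ** pdm k) (pdm k ** X k i)
| D_Tpp k :
    dyck_rel (X k.+2 1 ** d k.+1 ** d k) (d k.+1 ** d k)
| D_pT k i of (0 < i < k)%N :
    dyck_rel (d k ** X k i) (X k.+1 i.+1 ** d k)
| D_comm_m k of (2 <= k)%N :
    dyck_rel (pdm k ** pcomm k ** X k k.-1) (u *: (pcomm k.-1 ** pdm k))
| D_comm_p k of (1 <= k)%N :
    dyck_rel (X k.+1 1 ** pcomm k.+1 ** d k) (u *: (d k ** pcomm k)).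

(* X_n ... X_1 at the vertex k *)
Fixpoint pdesc (k n : nat) : P :=
  if n is m.+1 then X k n ** pdesc k m else pe k.

End Dyck.

(* As for [wy] and [wz], the index i starts at 1. *)
Fixpoint py (k i : nat) : P :=
  if i is (_.+1 as j).+1 then q *: (pTinv k j ** py k j ** pTinv k j)
  else (q ^+ k.-1 * (q - 1))^-1 *: (pcomm pdp k ** pdesc pT k k.-1).
Fixpoint pz (k i : nat) : P :=
  if i is (_.+1 as j).+1 then q^-1 *: (pT k j ** pz k j ** pT k j)
  else (q ^+ k / (1 - q)) *: (pcomm pds k ** pdesc pTinv k k.-1).

Variant Aqt_rel : P -> P -> Prop :=
| A_dyck x y of dyck_rel q pT pdp x y : Aqt_rel x y
| A_dyck_star x y of dyck_rel q^-1 pTinv pds x y : Aqt_rel x y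
| A_pz k i of (1 <= i <= k)%N :
    Aqt_rel (pdp k ** pz k i) (pz k.+1 i.+1 ** pdp k)
| A_sy k i of (1 <= i <= k)%N :
    Aqt_rel (pds k ** py k i) (py k.+1 i.+1 ** pds k)
| A_zy k :
    Aqt_rel (pz k.+1 1 ** pdp k) (- (t * q ^+ k.+1) *: (py k.+1 1 ** pds k)).

Definition Aqt := path_quot Aqt_rel.
HB.instance Definition _ := GRing.Lmodule.on Aqt.
HB.instance Definition _ := Semigroup.on Aqt.

Definition ae (k : nat) : Aqt := pq_class _ (pe k).
Definition aT (k i : nat) : Aqt := pq_class _ (pT k i).
Definition aTinv (k i : nat) : Aqt := pq_class _ (pTinv k i).
Definition ay (k i : nat) : Aqt := pq_class _ (py k i).
Definition az (k i : nat) : Aqt := pq_class _ (pz k i).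

Definition Aqt_loops (k : nat) := @loop R dyck_quiver Aqt_rel k.
HB.instance Definition _ k := Monoid.on (Aqt_loops k).

Lemma aT_e k i : aT k i ** ae k = aT k i /\ ae k ** aT k i = aT k i.
Proof.
rewrite /aT /ae -!classM /pT; case: decP => h.
  by split; congr pq_class; [exact: (@arr_idem R dyck_quiver (ArrT h))
                         | exact: (@idem_arr R dyck_quiver (ArrT h))].
by split; congr pq_class; [apply: pa_mul0l | apply: pa_mul0r].
Qed.

Lemma aT_inv k i : q \is a GRing.unit -> (0 < i < k)%N ->
  aT k i ** aTinv k i = ae k /\ aTinv k i ** aT k i = ae k.
Proof.
move=> uq ik; have [Te eT] := aT_e k i.
have ee : ae k ** ae k = ae k by apply: class_idem.
have quad : aT k i ** aT k i + (q - 1) *: aT k i = q *: ae k.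
  have := class_rel (A_dyck (D_quad q pT pdp ik)).
  rewrite classM classB classD classZ class0 -[pq_class _ (pT _ _)]/(aT k i).
  rewrite -[pq_class _ (pe _)]/(ae k) -scaleN1r pq_mulDl !pq_mulDr !pq_mulZr.
  rewrite !pq_mulZl Te eT ee !scaleN1r scalerBl scale1r => /eqP.
  by rewrite scalerN !addrA subr_eq0 => /eqP.
rewrite /aTinv /pTinv classZ classD classZ pq_mulZl pq_mulZr pq_mulDl pq_mulDr.
rewrite -/(aT k i) -/(ae k) pq_mulZl pq_mulZr Te eT quad scalerA mulVr //.
by rewrite scale1r.
Qed.

End DoubleDyck.

(* The inner variable is q and the outer one is t. *)
Definition Qqt := {fraction {poly {poly rat}}}.
HB.instance Definition _ := GRing.Field.on Qqt.
Definition Qqt_q : Qqt := tofrac ('X : {poly rat})%:P.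
Definition Qqt_t : Qqt := tofrac 'X.

(* Adjoining q^(1/2) to the scalars: A_{q,t}[q^(1/2)] is Aqt ext_q ext_t, the
   same presentation over Q(q,t)[q^(1/2)], while A_{q,t} is Aqt Qqt_q Qqt_t. *)
Definition Qqt_sqrt := {poly %/ ('X^2 - Qqt_q%:P)}.
HB.instance Definition _ := GRing.ComUnitAlgebra.on Qqt_sqrt.
Definition sqrt_q : Qqt_sqrt := 'qX.
Definition ext_q : Qqt_sqrt := Qqt_q%:A.
Definition ext_t : Qqt_sqrt := Qqt_t%:A.

Lemma sqrt_qE : sqrt_q ^+ 2 = ext_q.
Proof.
have hE : mk_monic ('X^2 - Qqt_q%:P) = 'X^2 - Qqt_q%:P.
  by rewrite /mk_monic size_XnsubC // monicXnsubC.
pose h : {poly Qqt} := 'X^2 - Qqt_q%:P.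
have -> : sqrt_q ^+ 2 = in_qpoly h ('X * 'X) by rewrite in_qpolyM.
have -> : ext_q = in_qpoly h Qqt_q%:P by rewrite -alg_polyC in_qpolyZ in_qpoly1.
apply/eqP; rewrite -subr_eq0 -[X in _ - X]scale1r -scaleNr -in_qpolyZ.
rewrite -in_qpolyD scaleN1r; apply/eqP/val_inj => /=.
by rewrite -expr2 hE Pdiv.RingMonic.rmodpp ?monicXnsubC.
Qed.

(* Main.v *)
Require Import Defs.
From HB Require Import structures.
From mathcomp Require Import all_boot all_order all_algebra zify ring.

Import GRing.Theory.
Local Open Scope ring_scope.

Set Implicit Arguments.
Unset Strict Implicit.
Unset Printing Implicit Defensive.

(** By the universal property of a presented monoid, it is enough to check the
    defining relations on the images of the generators. The factor [q^(-1/2)]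
    makes the scalars in [y_{i+1} = q T_i^-1 y_i T_i^-1] and
    [z_{i+1} = q^-1 T_i z_i T_i] disappear, so that the recursive definitions
    of the two sides agree. Every relation is then homogeneous in each family
    of generators, so the remaining scalars cancel. The inverse, braid
    and far commutation relations hold by definition.

    The relations between the [y_i] and the [T_j] and the commutations
    [y_i y_j = y_j y_i] follow formally, in any monoid, from two facts: [y_1]
    commutes with [T_j] for [j >= 2], and [y_1] commutes with [y_2]
    ([jucys_murphy_commute_generator], [jucys_murphy_commute]). Write
    [phi = d_+ d_- - d_- d_+] and [D = T_{k-1} .. T_1], so that [y_1] is a
    multiple of [phi D]. Commuting a [T] past [phi] raises its index by one,
    and commuting it past [D] lowers the index by one; this is the first fact.
    For the second one, [phi D T_1^-1 phi D = phi^2 D' D] with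
    [D' = T_{k-2} .. T_1], and the statement becomes
    [T_1 phi^2 = phi^2 T_{k-1}] together with [D D = T_{k-1} D' D = D' D T_1].
    The identity about [phi^2] is obtained by expanding one of the two factors
    and using the two relations that move [phi] past [d_-] and past [d_+]
    ([dyck_comm2_x], [dyck_loop_braid]).

    The relations of the algebra are symmetric under the exchange of
    [(q, T_i, d_+, y_i)] with [(q^-1, T_i^-1, d_+^*, z_i)], so the same
    lemmas give the statements about the [z_i].

    There remains the mixed relation, which reads
    [z_1 T_1 y_1 T_1^-1 = y_2 z_1]. Both [y_1] and [y_2] commute with [d_-],
    and [d_+^* y_1 = y_2 d_+^*]; hence
    [y_2 phi^* = phi^* y_1] for [phi^* = d_+^* d_- - d_- d_+^*]. As [z_1] is a
    multiple of [phi^* T_{k-1}^-1 .. T_1^-1] and [y_1] commutes with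
    [T_{k-1}, .., T_2], the relation follows ([dyck_loop_star_cross]). *)

(** * Morphisms from a presented monoid *)

Section PresentedMonoidMap.
Variables (G : choiceType) (rel : seq G -> seq G -> Prop).
Variables (M : monoidType) (g : G -> M).

Definition eval_word (s : seq G) : M := (\prod_(x <- s) g x)%g.

Lemma eval_word_cat s1 s2 :
  eval_word (s1 ++ s2) = (eval_word s1 * eval_word s2)%g.
Proof. exact: big_cat. Qed.

Hypothesis rel_eval : forall s1 s2, rel s1 s2 -> eval_word s1 = eval_word s2.

Lemma eval_word_cong s1 s2 : word_cong rel s1 s2 -> eval_word s1 = eval_word s2.
Proof.
elim=> // [u v w _ -> _ -> //|u u' v v' _ uu' _ vv'].
by rewrite !eval_word_cat uu' vv'.
Qed.

Lemma presented_monoid_map :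
  exists f : UMagmaMorphism.type (presented_monoid rel) M,
    forall s, f (word_class rel s) = eval_word s.
Proof.
pose f (x : presented_monoid rel) := eval_word (repr x).
have fE s : f (word_class rel s) = eval_word s.
  by apply: eval_word_cong; apply/word_classP; apply: word_class_repr.
have f_morph : {morph f : x y / (x * y)%g}.
  by move=> x y; rewrite -eval_word_cat -fE.
have f_one : f 1%g = 1%g by rewrite [LHS]fE /eval_word big_nil.
pose mf := isUMagmaMorphism.Build _ _ f (f_one, f_morph).
exists (HB.pack f mf : UMagmaMorphism.type _ _); exact: fE.
Qed.

End PresentedMonoidMap.

(** * Jucys-Murphy elements of a braid representation *)

Section AffineBraid.
Variables (M : monoidType) (k : nat) (v w y : nat -> M).
Local Open Scope group_scope.

Hypothesis vw : forall i, (0 < i < k)%N -> v i * w i = 1.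
Hypothesis wv : forall i, (0 < i < k)%N -> w i * v i = 1.
Hypothesis v_braid : forall i, (0 < i)%N -> (i.+1 < k)%N ->
  v i * v i.+1 * v i = v i.+1 * v i * v i.+1.
Hypothesis v_far : forall i j, (0 < i < k)%N -> (0 < j < k)%N ->
  (i.+1 < j)%N || (j.+1 < i)%N -> commute (v i) (v j).
Hypothesis yS : forall i, (0 < i)%N -> y i.+1 = v i * y i * v i.
Hypothesis y1_far : forall j, (1 < j < k)%N -> commute (y 1) (v j).

Lemma commute_inverse a i : (0 < i < k)%N ->
  commute a (v i) -> commute a (w i).
Proof.
move=> ik av; rewrite /commute -[a * w i]mul1g -(wv ik) -!mulgA.
by congr (_ * _); rewrite !mulgA -av -mulgA vw // mulg1.
Qed.

(** By induction on [i]: conjugating by [v_{i-1}] preserves commutation with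
    every [v_j] that commutes with [v_{i-1}]. The exception is [j = i-2], where
    two steps of the recursion are unfolded and the braid relation turns [v_j]
    into [v_{i-1}], which commutes with [y_{i-2}]. *)
Lemma jucys_murphy_commute_generator i j : (0 < i <= k)%N -> (0 < j < k)%N ->
  i != j -> i != j.+1 -> commute (y i) (v j).
Proof.
elim/ltn_ind: i j => -[|[|i]] // IH j ik jk ij ij1.
  by apply: y1_far; rewrite ltn_neqAle ij.
rewrite eqSS in ij1.
have i1k : (0 < i.+1 < k)%N by [].
rewrite yS //.
have far : (i.+2 < j)%N || (j < i)%N || (j == i).
  by case: (ltngtP j i) => //= lt_ij; rewrite orbF; lia.
case/orP: far => [|/eqP ji].
  move=> far; have vj : commute (v j) (v i.+1).
    by apply: v_far => //; rewrite ?ltnS orbC.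
  have yj : commute (v j) (y i.+1).
    by apply/commute_sym/IH => //; lia.
  apply: commute_sym; apply: commuteM => //; exact: commuteM.
(* Here the generator is v_i and the element is y_{i+2}. *)
subst j.
rewrite yS; last lia.
have ci : commute (y i) (v i.+1) by apply: IH; lia.
have br : v i * v i.+1 * v i = v i.+1 * v i * v i.+1 by apply: v_braid; lia.
rewrite /commute.
have -> : v i.+1 * (v i * y i * v i) * v i.+1 * v i
        = v i.+1 * v i * y i * (v i * v i.+1 * v i) by rewrite !mulgA.
rewrite br !mulgA -[_ * y i * v i.+1]mulgA ci.
by rewrite !mulgA -br.
Qed.

Hypothesis y1_y2 : (1 < k)%N -> commute (y 1) (y 2).

(** Since [y_{j+1} = v_j y_j v_j] and [y_i] commutes with [v_j] for [i < j],
    every commutation reduces to that of [y_1] and [y_2]. *)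
Lemma jucys_murphy_commute i j : (0 < i <= k)%N -> (0 < j <= k)%N ->
  commute (y i) (y j).
Proof.
wlog lt_ij : i j / (i < j)%N => [H ik jk|].
  have [/H h|/H h|->] := ltngtP i j; last exact: commute_refl.
    exact: h.
  exact/commute_sym/h.
elim: i j lt_ij => [//|[|i] IH] j ij ik jk.
  elim: j ij jk => [//|[//|[|j]] IHj] _ jk; first by apply: y1_y2; lia.
  rewrite (@yS j.+2); last lia.
  have yv : commute (y 1) (v j.+2) by apply: y1_far; lia.
  by apply: commuteM => //; apply: commuteM => //; apply: IHj; lia.
have yv : commute (y j) (v i.+1).
  by apply: jucys_murphy_commute_generator; lia.
rewrite (@yS i.+1); last lia.
apply: commute_sym; apply: commuteM => //; apply: commuteM => //.
by apply/commute_sym/IH; lia.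
Qed.

End AffineBraid.

(** * Half of the double Dyck path algebra *)

(** A path algebra on infinitely many vertices has no unit, hence is not an
    algebra in the usual sense: it is a module with this structure. *)
Record bilinear_assoc (R : comUnitRingType) (A : lmodType R)
    (mul : A -> A -> A) : Prop := BilinearAssoc {
  bmulA : associative mul;
  bmulDl : left_distributive mul +%R;
  bmulDr : right_distributive mul +%R;
  bmulZl : forall c a b, mul (c *: a) b = c *: mul a b;
  bmulZr : forall c a b, mul a (c *: b) = c *: mul a b }.

Section DyckHalf.
Variables (R : comUnitRingType) (A : lmodType R) (mul : A -> A -> A) (u : R).
Variables (e m d : nat -> A) (x : nat -> nat -> A).
Local Notation "a ** b" := (mul a b) : ring_scope.

Definition dyck_comm (k : nat) : A := d k.-1 ** m k - m k.+1 ** d k.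

Fixpoint dyck_desc (k n : nat) : A :=
  if n is n'.+1 then x k n ** dyck_desc k n' else e k.

(** Up to a scalar this is the loop [y_1], or [z_1] in the dual half. *)
Definition dyck_loop (k : nat) : A := dyck_comm k ** dyck_desc k k.-1.

(** The index [k] is the vertex where a path begins, [e k] is the idempotent
    there and [m] stands for [d_-]. The pair [(d, x)] is either [(d_+, T)],
    with [u = q], or [(d_+^*, T^-1)], with [u = q^-1]. *)
Record dyck_half : Prop := DyckHalf {
  dh_em : forall k, e k ** m k.+1 = m k.+1;
  dh_me : forall k, m k ** e k = m k;
  dh_ed : forall k, e k.+1 ** d k = d k;
  dh_de : forall k, d k ** e k = d k;
  dh_ex : forall k i, e k ** x k i = x k i;
  dh_xe : forall k i, x k i ** e k = x k i;
  dh_braid : forall k i, (0 < i)%N -> (i.+1 < k)%N ->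
    x k i ** x k i.+1 ** x k i = x k i.+1 ** x k i ** x k i.+1;
  dh_far : forall k i j, (0 < i < k)%N -> (0 < j < k)%N ->
    (i.+1 < j)%N || (j.+1 < i)%N -> x k i ** x k j = x k j ** x k i;
  dh_xm : forall k i, (0 < i)%N -> (i.+1 < k)%N ->
    x k.-1 i ** m k = m k ** x k i;
  dh_dx : forall k i, (0 < i < k)%N -> d k ** x k i = x k.+1 i.+1 ** d k;
  dh_comm_m : forall k, (1 < k)%N ->
    m k ** dyck_comm k ** x k k.-1 = u *: (dyck_comm k.-1 ** m k);
  dh_comm_d : forall k, (0 < k)%N ->
    x k.+1 1 ** dyck_comm k.+1 ** d k = u *: (d k ** dyck_comm k) }.

Hypothesis mulP : bilinear_assoc mul.
Hypothesis dyckP : dyck_half.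

Let mulA := bmulA mulP.
Let mulDl := bmulDl mulP.
Let mulDr := bmulDr mulP.
Let mulZl := bmulZl mulP.
Let mulZr := bmulZr mulP.

Let mulNl a b : (- a) ** b = - (a ** b).
Proof. by rewrite -scaleN1r mulZl scaleN1r. Qed.
Let mulNr a b : a ** (- b) = - (a ** b).
Proof. by rewrite -scaleN1r mulZr scaleN1r. Qed.

Local Notation phi := dyck_comm.
Local Notation D := dyck_desc.
Local Notation Y := dyck_loop.

Lemma dyck_descS k n : D k n.+1 = x k n.+1 ** D k n.
Proof. by []. Qed.

Lemma dyck_comm_e k : phi k ** e k = phi k.
Proof. by rewrite mulDl mulNl -!mulA dh_me // dh_de. Qed.

Lemma e_dyck_comm k : (0 < k)%N -> e k ** phi k = phi k.
Proof.
by case: k => // k _; rewrite mulDr mulNr !mulA dh_em // dh_ed.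
Qed.

Lemma e_dyck_desc k n : e k ** e k = e k -> e k ** D k n = D k n.
Proof. by move=> ee; case: n => //= n; rewrite mulA dh_ex. Qed.

Lemma dyck_desc_e k n : e k ** e k = e k -> D k n ** e k = D k n.
Proof. by move=> ee; elim: n => //= n IH; rewrite -mulA IH. Qed.

(** In both [d_+ d_-] and [d_- d_+] the index of [x_i] goes up by one when it
    passes [d_+] and stays the same when it passes [d_-]. *)
Lemma dyck_comm_x k i : (0 < i)%N -> (i.+1 < k)%N ->
  phi k ** x k i = x k i.+1 ** phi k.
Proof.
case: k => // k i0 ik; rewrite mulDl mulDr mulNl mulNr /=.
congr (_ - _).
  by rewrite -mulA -(dh_xm dyckP) //= !mulA dh_dx // i0.
rewrite -mulA dh_dx //; last by rewrite i0; lia.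
by rewrite !mulA -(dh_xm dyckP (k := k.+2)).
Qed.

Lemma dyck_desc_far k n j : e k ** e k = e k -> (n < j.-1)%N -> (j < k)%N ->
  D k n ** x k j = x k j ** D k n.
Proof.
move=> ee; elim: n => [|n IH] /= nj jk; first by rewrite dh_ex // dh_xe.
by rewrite -mulA IH ?mulA ?(dh_far dyckP (i := n.+1) (j := j)) //; lia.
Qed.

(** The braid relation: [x_j x_{j-1} x_j = x_{j-1} x_j x_{j-1}], all other
    factors of the product commuting with [x_j] or with [x_{j-1}]. *)
Lemma dyck_desc_x k n j : e k ** e k = e k ->
  (1 < j)%N -> (j <= n)%N -> (n < k)%N ->
  D k n ** x k j = x k j.-1 ** D k n.
Proof.
move=> ee j1; elim: n => [|n IH] /=; first lia.
rewrite leq_eqVlt ltnS => /orP[/eqP jn|jn] nk; last first.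
  by rewrite -mulA IH ?mulA ?(dh_far dyckP (i := n.+1)) //; lia.
subst j; case: n {IH} j1 nk => [//|n] _ nk /=.
rewrite -!mulA dyck_desc_far //.
by rewrite !mulA -(dh_braid dyckP).
Qed.

(** The product [x_{k-1} .. x_1] lowers the index [j] by one and the commutator
    raises it again. *)
Lemma dyck_loop_x k j : e k ** e k = e k -> (1 < j < k)%N ->
  Y k ** x k j = x k j ** Y k.
Proof.
move=> ee /andP[j1 jk]; rewrite /Y -mulA dyck_desc_x //; [|lia..].
by rewrite mulA dyck_comm_x ?mulA; [congr (x k _ ** _ ** _)| |]; lia.
Qed.

(** Each factor but [x_1] of the right-hand product passes to the left with its
    index lowered by one. *)
Lemma dyck_desc_mul k n p : e k ** e k = e k -> (n < p)%N -> (p < k)%N ->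
  D k p ** D k n.+1 = D k n ** D k p ** x k 1.
Proof.
move=> ee np pk; elim: n np => [|n IH] np.
  by rewrite /= e_dyck_desc // dh_xe.
rewrite dyck_descS mulA dyck_desc_x //; [|lia..].
by rewrite -mulA IH ?mulA //; lia.
Qed.

(** The scalar [u] comes from moving [d_-] past the commutator, which creates
    the extra factor [x_{k-1}] by which the two products differ. *)
Lemma dyck_loop_m k : (1 < k)%N -> u *: (Y k.-1 ** m k) = m k ** Y k.
Proof.
case: k => [|[|k]] // _.
have Dm n : (n <= k)%N -> D k.+1 n ** m k.+2 = m k.+2 ** D k.+2 n.
  elim: n => [|n IH] nk /=; first by rewrite dh_em // dh_me.
  by rewrite -mulA IH 1?ltnW // !mulA (dh_xm dyckP (k := k.+2)).
rewrite /Y -mulA Dm // mulA -mulZl -(dh_comm_m dyckP (k := k.+2)) //.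
by rewrite /= !mulA.
Qed.

Hypothesis u_unit : u \is a GRing.unit.

(** Expanding the second factor on the left and the first one on the right,
    both sides become
    [u d_+ phi d_- - u^-1 d_- x_1 phi x_k d_+]. *)
Lemma dyck_comm2_x k : (1 < k)%N ->
  x k 1 ** (phi k ** phi k) = phi k ** phi k ** x k k.-1.
Proof.
case: k => [|[|k]] // _.
have dphi : d k.+2 ** phi k.+2 = u^-1 *: (x k.+3 1 ** phi k.+3 ** d k.+2).
  by rewrite dh_comm_d // scalerA mulVr // scale1r.
have phim : phi k.+2 ** m k.+3 = u^-1 *: (m k.+3 ** phi k.+3 ** x k.+3 k.+2).
  by rewrite dh_comm_m // scalerA mulVr // scale1r.
have xm : x k.+2 1 ** m k.+3 = m k.+3 ** x k.+3 1 by rewrite -(dh_xm dyckP).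
have phiE : phi k.+2 = d k.+1 ** m k.+2 - m k.+3 ** d k.+2 by [].
transitivity (u *: (d k.+1 ** phi k.+1 ** m k.+2)
   - u^-1 *: (m k.+3 ** x k.+3 1 ** phi k.+3 ** x k.+3 k.+2 ** d k.+2)).
  rewrite {2}phiE mulDr mulNr mulDr mulNr; congr (_ - _).
    by rewrite !mulA dh_comm_d // mulZl.
  by rewrite [phi _ ** (_ ** _)]mulA phim mulZl mulZr !mulA xm.
rewrite {1}phiE mulDl mulNl mulDl mulNl; congr (_ - _).
  by rewrite -!mulA [m _ ** _]mulA dh_comm_m // mulZr !mulA.
rewrite -[m k.+3 ** d _ ** _]mulA dphi mulZr mulZl -!mulA /=.
by rewrite (dh_dx dyckP) /= ?ltnSn.
Qed.

Section Inverses.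
Variable v : nat -> nat -> A.
Hypothesis xv : forall k i, (0 < i < k)%N -> x k i ** v k i = e k.
Hypothesis vx : forall k i, (0 < i < k)%N -> v k i ** x k i = e k.
Hypothesis ee : forall k, e k ** e k = e k.

Lemma dyck_desc_v_comm k n : (n.+1 < k)%N ->
  D k n.+1 ** v k 1 ** phi k = phi k ** D k n.
Proof.
elim: n => [|n IH] nk.
  by rewrite /= dh_xe // xv // e_dyck_comm ?dyck_comm_e //; lia.
rewrite dyck_descS -2!(mulA (x k n.+2)) IH //; last lia.
by rewrite !mulA dyck_comm_x.
Qed.

(** In terms of [y_2 = v_1 y_1 v_1] this is [y_1 y_2 = y_2 y_1]. *)
Lemma dyck_loop_braid k : (1 < k)%N ->
  Y k ** v k 1 ** Y k ** v k 1 = v k 1 ** Y k ** v k 1 ** Y k.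
Proof.
case: k => [|[|k]] // _.
have YvY : Y k.+2 ** v k.+2 1 ** Y k.+2
         = phi k.+2 ** phi k.+2 ** D k.+2 k ** D k.+2 k.+1.
  have YE : Y k.+2 = phi k.+2 ** D k.+2 k.+1 by [].
  rewrite YE (mulA _ (phi _)) -2!(mulA (phi k.+2)).
  by rewrite dyck_desc_v_comm ?ltnSn // mulA.
have xDDv : x k.+2 k.+1 ** (D k.+2 k ** D k.+2 k.+1) ** v k.+2 1
          = D k.+2 k ** D k.+2 k.+1.
  transitivity (D k.+2 k.+1 ** D k.+2 k.+1 ** v k.+2 1).
    by rewrite {3}dyck_descS !mulA.
  rewrite dyck_desc_mul //.
  by rewrite -mulA xv // -mulA dyck_desc_e.
have vphix : v k.+2 1 ** (phi k.+2 ** phi k.+2) ** x k.+2 k.+1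
           = phi k.+2 ** phi k.+2.
  rewrite -mulA -[k.+1]/(k.+2.-1) -dyck_comm2_x // mulA vx // mulA.
  by rewrite e_dyck_comm.
transitivity (v k.+2 1 ** (Y k.+2 ** v k.+2 1 ** Y k.+2)); last first.
  by rewrite !mulA.
rewrite YvY -(mulA (phi _ ** _)).
(* With p = phi^2 and dd = D' D, both sides are v p x dd v. *)
move: (phi _ ** _) (D _ _ ** _) vphix xDDv => p dd vpx xdv.
by rewrite -[in RHS]xdv !mulA vpx.
Qed.

End Inverses.
End DyckHalf.

(** * The mixed relation *)

Section DoubleDyck.
Variables (R : comUnitRingType) (A : lmodType R) (mul : A -> A -> A) (q : R).
Variables (e m d ds : nat -> A) (x v : nat -> nat -> A) (cy cz : nat -> R).
Variables y z : nat -> nat -> A.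
Local Notation "a ** b" := (mul a b) : ring_scope.

(** The family [cy] gives the normalization [1 / (q^(k-1) (q - 1))] of [y_1];
    its value at [k - 1] is [q] times its value at [k], which cancels the scalar
    of [dyck_loop_m]. *)
Record double_dyck : Prop := DoubleDyckAxioms {
  dd_mul : bilinear_assoc mul;
  dd_half : dyck_half mul q e m d x;
  dd_star : dyck_half mul q^-1 e m ds v;
  dd_ee : forall k, e k ** e k = e k;
  dd_xv : forall k i, (0 < i < k)%N -> x k i ** v k i = e k;
  dd_vx : forall k i, (0 < i < k)%N -> v k i ** x k i = e k;
  dd_y1 : forall k, y k 1 = cy k *: dyck_loop mul e m d x k;
  dd_yS : forall k i, (0 < i)%N ->
    y k i.+1 = q *: (v k i ** y k i ** v k i);
  dd_z1 : forall k, z k 1 = cz k *: dyck_loop mul e m ds v k;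
  dd_zS : forall k i, (0 < i)%N ->
    z k i.+1 = q^-1 *: (x k i ** z k i ** x k i);
  dd_cy : forall k, (1 < k)%N -> cy k.-1 = cy k * q;
  dd_ds_y : forall k, (0 < k)%N -> ds k ** y k 1 = y k.+1 2 ** ds k }.

Hypothesis ddP : double_dyck.
Hypothesis q_unit : q \is a GRing.unit.

Local Notation phis := (dyck_comm mul m ds).
Local Notation Ds := (dyck_desc mul e v).
Local Notation Ys := (dyck_loop mul e m ds v).

Let ee := dd_ee ddP.
Let xv := dd_xv ddP.
Let vx := dd_vx ddP.
Let y1E := dd_y1 ddP.
Let y2E k : y k 2 = q *: (v k 1 ** y k 1 ** v k 1) := dd_yS ddP k (ltn0Sn 0).
Let cE := dd_cy ddP.
Let ds_y := dd_ds_y ddP.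
Let mulA := bmulA (dd_mul ddP).
Let mulDl := bmulDl (dd_mul ddP).
Let mulDr := bmulDr (dd_mul ddP).
Let mulZl := bmulZl (dd_mul ddP).
Let mulZr := bmulZr (dd_mul ddP).

Lemma y1_m k : (1 < k)%N -> y k.-1 1 ** m k = m k ** y k 1.
Proof.
move=> k1; rewrite !y1E mulZl mulZr cE //.
by rewrite -(dyck_loop_m (dd_mul ddP) (dd_half ddP)) // scalerA.
Qed.

Lemma y2_m k : (2 < k)%N -> y k.-1 2 ** m k = m k ** y k 2.
Proof.
move=> k2; have vm : v k.-1 1 ** m k = m k ** v k 1.
  exact: (dh_xm (dd_star ddP)).
rewrite !y2E mulZl mulZr; congr (_ *: _).
rewrite -mulA vm mulA -(mulA (v _ _)) y1_m; last lia.
by rewrite mulA vm !mulA.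
Qed.

(** The relation [d_+^* y_1 = y_2 d_+^*] and the commutation of [y_1] and [y_2]
    with [d_-], applied to the two terms of the commutator. *)
Lemma y2_phis k : (1 < k)%N -> y k 2 ** phis k = phis k ** y k 1.
Proof.
case: k => // k k1.
rewrite /dyck_comm mulDl mulDr -!scaleN1r mulZl mulZr /=; congr (_ + _ *: _).
  by rewrite mulA -ds_y // -!mulA -y1_m.
by rewrite mulA (@y2_m k.+2) // -!mulA ds_y.
Qed.

Lemma e_y1 k : (0 < k)%N -> e k ** y k 1 = y k 1.
Proof.
by move=> k0; rewrite y1E mulZr mulA (e_dyck_comm (dd_mul ddP) (dd_half ddP)).
Qed.

Lemma y1_e k : y k 1 ** e k = y k 1.
Proof.
by rewrite y1E mulZl -mulA (dyck_desc_e _ (dd_mul ddP)).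
Qed.

Lemma y1_v k j : (1 < j < k)%N -> v k j ** y k 1 = y k 1 ** v k j.
Proof.
move=> jk; have j0 : (0 < j < k)%N by lia.
have yx : y k 1 ** x k j = x k j ** y k 1.
  by rewrite y1E mulZl mulZr (dyck_loop_x (dd_mul ddP) (dd_half ddP)).
rewrite -[in LHS]y1_e -(xv j0) !mulA -[_ ** x k j]mulA yx !mulA vx //.
by rewrite e_y1 //; lia.
Qed.

(** Only the last factor [v_1] of the product does not commute with [y_1], and
    [x_1] cancels it. *)
Lemma y1_desc k n : (0 < k)%N -> (n.+1 < k)%N ->
  Ds k n.+1 ** x k 1 ** y k 1 ** v k 1 = y k 1 ** Ds k n.+1.
Proof.
move=> k0; elim: n => [|n IH] nk.
  rewrite /= -!mulA (mulA (e k)) (dh_ex (dd_half ddP)) mulA vx //.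
  by rewrite mulA e_y1 // (dh_xe (dd_star ddP)).
rewrite dyck_descS -3!(mulA (v k _)) IH; last lia.
by rewrite !mulA y1_v.
Qed.

Lemma dyck_loop_star_cross k : (1 < k)%N ->
  Ys k ** x k 1 ** y k 1 ** v k 1 = y k 2 ** Ys k.
Proof.
case: k => [|[|k]] // _.
have -> : Ys k.+2 = phis k.+2 ** Ds k.+2 k.+1 by [].
by rewrite -3!(mulA (phis _)) y1_desc // (mulA (y _ 2)) y2_phis // mulA.
Qed.


(** * The representation on the loops at a vertex *)

(** The monoid [M] is that of the loops at [k], known through an injection
    [val] into the algebra and a section [corner] of it, defined on the whole
    algebra. *)
Variables (s r : R) (k : nat).
Hypothesis s2 : s * s = q.
Hypothesis k0 : (0 < k)%N.
Variables (M : monoidType) (val : M -> A) (corner : A -> M).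
Hypothesis val_inj : injective val.
Hypothesis valM : forall a b : M, val (a * b)%g = val a ** val b.
Hypothesis val1 : val 1%g = e k.
Hypothesis cornerK : forall a, e k ** a = a -> a ** e k = a ->
  val (corner a) = a.

Definition gen_image (b : bgen k) : M :=
  match b with
  | @GenT _ i _ => corner (s^-1 *: x k i)
  | @GenTinv _ i _ => corner (s *: v k i)
  | Geny1 => corner (- y k 1)
  | Genz1 => corner (r *: z k 1)
  end.

Local Notation ev := (eval_word gen_image).
Local Notation T i := (ev (wT k i)).
Local Notation V i := (ev (wTinv k i)).
Local Notation Y i := (ev (wy k i)).
Local Notation Z i := (ev (wz k i)).

Let s_unit : s \is a GRing.unit.
Proof. by move: q_unit; rewrite -s2 unitrM => /andP[]. Qed.
Let s2V : s^-1 * s^-1 = q^-1.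
Proof. by rewrite -s2 invrM. Qed.

Lemma val_eval_T i : (0 < i < k)%N -> val (T i) = s^-1 *: x k i.
Proof.
move=> ik; rewrite /wT; case: decP => // h; rewrite /eval_word big_seq1 /=.
by rewrite cornerK ?mulZl ?mulZr ?(dh_ex (dd_half ddP)) ?(dh_xe (dd_half ddP)).
Qed.

Lemma val_eval_V i : (0 < i < k)%N -> val (V i) = s *: v k i.
Proof.
move=> ik; rewrite /wTinv; case: decP => // h; rewrite /eval_word big_seq1 /=.
by rewrite cornerK ?mulZl ?mulZr ?(dh_ex (dd_star ddP)) ?(dh_xe (dd_star ddP)).
Qed.

Lemma val_eval_y1 : val (Y 1) = - y k 1.
Proof.
rewrite /eval_word big_seq1 /= -scaleN1r.
by rewrite cornerK ?mulZl ?mulZr ?e_y1 ?y1_e.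
Qed.

Lemma val_eval_z1 : val (Z 1) = r *: z k 1.
Proof.
rewrite /eval_word big_seq1 /= (dd_z1 ddP) scalerA.
rewrite cornerK ?mulZl ?mulZr //; congr (_ *: _).
  by rewrite mulA (e_dyck_comm (dd_mul ddP) (dd_star ddP)).
by rewrite -mulA (dyck_desc_e _ (dd_mul ddP)).
Qed.

Lemma eval_yS i : (0 < i)%N -> Y i.+1 = (V i * Y i * V i)%g.
Proof. by case: i => // i _; rewrite /= !eval_word_cat mulgA. Qed.

Lemma eval_zS i : (0 < i)%N -> Z i.+1 = (T i * Z i * T i)%g.
Proof. by case: i => // i _; rewrite /= !eval_word_cat mulgA. Qed.

Lemma val_eval_y i : (0 < i <= k)%N -> val (Y i) = - y k i.
Proof.
elim: i => // -[|i] IH ik; first exact: val_eval_y1.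
rewrite eval_yS // !valM val_eval_V ?IH; [|lia..].
rewrite (dd_yS ddP _ (ltn0Sn i)) -s2 -!scaleN1r !(mulZl, mulZr) !scalerA.
by congr (_ *: _); rewrite mulrC mulrA.
Qed.

Lemma val_eval_z i : (0 < i <= k)%N -> val (Z i) = r *: z k i.
Proof.
elim: i => // -[|i] IH ik; first exact: val_eval_z1.
rewrite eval_zS // !valM val_eval_T ?IH; [|lia..].
rewrite (dd_zS ddP _ (ltn0Sn i)) -s2V !(mulZl, mulZr) !scalerA.
by congr (_ *: _); rewrite mulrC mulrA.
Qed.

Lemma eval_TV i : (0 < i < k)%N -> (T i * V i = 1)%g.
Proof.
move=> ik; apply: val_inj; rewrite valM val_eval_T // val_eval_V // val1.
by rewrite mulZl mulZr scalerA mulVr // scale1r xv.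
Qed.

Lemma eval_VT i : (0 < i < k)%N -> (V i * T i = 1)%g.
Proof.
move=> ik; apply: val_inj; rewrite valM val_eval_T // val_eval_V // val1.
by rewrite mulZl mulZr scalerA mulrV // scale1r vx.
Qed.

Lemma eval_T_braid i : (0 < i)%N -> (i.+1 < k)%N ->
  (T i * T i.+1 * T i = T i.+1 * T i * T i.+1)%g.
Proof.
move=> i0 ik; apply: val_inj; rewrite !valM !val_eval_T; [|lia..].
by rewrite !(mulZl, mulZr) (dh_braid (dd_half ddP)).
Qed.

Lemma eval_V_braid i : (0 < i)%N -> (i.+1 < k)%N ->
  (V i * V i.+1 * V i = V i.+1 * V i * V i.+1)%g.
Proof.
move=> i0 ik; apply: val_inj; rewrite !valM !val_eval_V; [|lia..].
by rewrite !(mulZl, mulZr) (dh_braid (dd_star ddP)).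
Qed.

Lemma eval_T_far i j : (0 < i < k)%N -> (0 < j < k)%N ->
  (i.+1 < j)%N || (j.+1 < i)%N -> commute (T i) (T j).
Proof.
move=> ik jk ij; apply: val_inj; rewrite !valM !val_eval_T //.
by rewrite !(mulZl, mulZr) (dh_far (dd_half ddP)).
Qed.

Lemma eval_V_far i j : (0 < i < k)%N -> (0 < j < k)%N ->
  (i.+1 < j)%N || (j.+1 < i)%N -> commute (V i) (V j).
Proof.
move=> ik jk ij; apply: val_inj; rewrite !valM !val_eval_V //.
by rewrite !(mulZl, mulZr) (dh_far (dd_star ddP)).
Qed.

Lemma eval_y1_far j : (1 < j < k)%N -> commute (Y 1) (V j).
Proof.
move=> jk; have j0 : (0 < j < k)%N by lia.
apply: val_inj; rewrite !valM val_eval_y1 val_eval_V // -scaleN1r.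
by rewrite !(mulZl, mulZr) y1_v // scalerA mulrC -scalerA.
Qed.

(** The loop [z_1] is built from the [T_i^-1], so it is the commutation with
    these inverses that is obtained first. *)
Lemma eval_z1_far j : (1 < j < k)%N -> commute (Z 1) (T j).
Proof.
move=> jk; have j0 : (0 < j < k)%N by lia.
apply: (commute_inverse (k := k) (v := fun i => V i) (w := fun i => T i)) => //.
- exact: eval_VT.
- exact: eval_TV.
apply: val_inj; rewrite !valM val_eval_z1 val_eval_V // (dd_z1 ddP).
rewrite !(mulZl, mulZr) (dyck_loop_x (dd_mul ddP) (dd_star ddP)) //.
by rewrite !scalerA; congr (_ *: _); rewrite mulrC mulrA.
Qed.

Lemma eval_y1_y2 : (1 < k)%N -> commute (Y 1) (Y 2).
Proof.
move=> k1; rewrite (@eval_yS 1) //; apply: val_inj.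
have vYvY := dyck_loop_braid (dd_mul ddP) (dd_half ddP) q_unit xv vx ee k1.
rewrite !valM val_eval_y1 val_eval_V // y1E -scaleN1r.
move: (dyck_loop _ _ _ _ _ _) vYvY => loop_k vYvY.
rewrite !(mulZl, mulZr) !scalerA.
by rewrite !mulA vYvY; congr (_ *: _); ring.
Qed.

Lemma eval_z1_z2 : (1 < k)%N -> commute (Z 1) (Z 2).
Proof.
move=> k1; rewrite (@eval_zS 1) //; apply: val_inj.
have qV_unit : q^-1 \is a GRing.unit by rewrite unitrV.
have xZxZ := dyck_loop_braid (dd_mul ddP) (dd_star ddP) qV_unit vx xv ee k1.
rewrite !valM val_eval_z1 val_eval_T // (dd_z1 ddP).
move: (dyck_loop _ _ _ _ _ _) xZxZ => loop_k xZxZ.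
rewrite !(mulZl, mulZr) !scalerA.
by rewrite !mulA xZxZ; congr (_ *: _); ring.
Qed.

(** The right-hand side is [y_2 z_1]: see [dyck_loop_star_cross]. *)
Lemma eval_zy_cross : (1 < k)%N ->
  (Z 1 * (T 1 * (Y 1 * V 1)) = V 1 * (Y 1 * (V 1 * Z 1)))%g.
Proof.
move=> k1; rewrite [RHS](_ : _ = Y 2 * Z 1)%g; last first.
  by rewrite (@eval_yS 1) // !mulgA.
apply: val_inj.
rewrite !valM val_eval_y1 val_eval_z1 val_eval_T // val_eval_V // val_eval_y //.
have y2Z := dyck_loop_star_cross k1.
rewrite (dd_z1 ddP) -!scaleN1r.
move: (dyck_loop _ _ _ _ _ _) y2Z => loop_k y2Z.
rewrite !(mulZl, mulZr) !scalerA !mulA -y2Z //; congr (_ *: _).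
by rewrite mulrAC divrK // mulrC mulrA.
Qed.

Lemma gen_image_rel a b : Bplus_rel (k := k) a b -> ev a = ev b.
Proof.
have yT i j : (0 < i <= k)%N -> (0 < j < k)%N -> i != j -> i != j.+1 ->
    commute (Y i) (T j).
  move=> ik jk ij ij1.
  apply: (commute_inverse (k := k) (v := fun i => V i)
    (w := fun i => T i)) => //.
  - exact: eval_VT.
  - exact: eval_TV.
  exact: (jucys_murphy_commute_generator (k := k) (v := fun i => V i)
    (y := fun i => Y i) eval_V_braid eval_V_far eval_yS eval_y1_far).
case=> {a b}.
- by move=> i ik; rewrite eval_word_cat eval_TV // /eval_word big_nil.
- by move=> i ik; rewrite eval_word_cat eval_VT // /eval_word big_nil.
- by move=> i i0 ik; rewrite !eval_word_cat !mulgA eval_T_braid.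
- by move=> i j ik jk ij; rewrite !eval_word_cat; apply: eval_T_far.
- by move=> i j ik jk ij ij1; rewrite !eval_word_cat; apply: yT.
- move=> i j ik jk ij ij1; rewrite !eval_word_cat.
  exact: (jucys_murphy_commute_generator (k := k) (v := fun i => T i)
    (y := fun i => Z i) eval_T_braid eval_T_far eval_zS eval_z1_far).
- move=> i j ik jk; rewrite !eval_word_cat.
  exact: (jucys_murphy_commute (k := k) (v := fun i => V i)
    (y := fun i => Y i) eval_V_braid eval_V_far eval_yS eval_y1_far eval_y1_y2).
- move=> i j ik jk; rewrite !eval_word_cat.
  exact: (jucys_murphy_commute (k := k) (v := fun i => T i)
    (y := fun i => Z i) eval_T_braid eval_T_far eval_zS eval_z1_far eval_z1_z2).
by move=> k1; rewrite !eval_word_cat eval_zy_cross.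
Qed.

Lemma double_dyck_representation :
  exists f : UMagmaMorphism.type (Bplus k) M,
    [/\ forall i, (0 < i < k)%N -> val (f (BT k i)) = s^-1 *: x k i,
        forall i, (0 < i <= k)%N -> val (f (By k i)) = - y k i
      & forall i, (0 < i <= k)%N -> val (f (Bz k i)) = r *: z k i].
Proof.
have [f fE] := presented_monoid_map gen_image_rel.
exists f; split=> i ik; rewrite fE.
- exact: val_eval_T.
- exact: val_eval_y.
- exact: val_eval_z.
Qed.

End DoubleDyck.

(** * The quotient of the path algebra *)

(** The map [cl] stands for the projection from the path algebra to the
    algebra defined by the relations; it is used through its linearity,
    multiplicativity and vanishing on the relations. *)
Section PathAlgebraQuotient.
Variables (R : comUnitRingType) (q t : R) (A : lmodType R).
Variables (mul : A -> A -> A) (cl : path_algebra R dyck_quiver -> A).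
Hypothesis mulP : bilinear_assoc mul.
Hypothesis clM : forall a b, cl (a ** b) = mul (cl a) (cl b).
Hypothesis clB : forall a b, cl (a - b) = cl a - cl b.
Hypothesis clZ : forall c a, cl (c *: a) = c *: cl a.
Hypothesis cl_rel : forall a b, Aqt_rel q t a b -> cl a = cl b.

Local Notation e := (fun k => cl (pe R k)).
Local Notation m := (fun k => cl (pdm R k)).

Section Half.
Variables (u : R) (X : nat -> nat -> path_algebra R dyck_quiver).
Variable D : nat -> path_algebra R dyck_quiver.
Hypothesis dyckA : forall a b, dyck_rel u X D a b -> Aqt_rel q t a b.
Hypothesis eD : forall k, pe R k.+1 ** D k = D k.
Hypothesis De : forall k, D k ** pe R k = D k.
Hypothesis eX : forall k i, pe R k ** X k i = X k i.
Hypothesis Xe : forall k i, X k i ** pe R k = X k i.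

Lemma class_pcomm k :
  cl (pcomm D k) = dyck_comm mul m (fun k => cl (D k)) k.
Proof.
exact: etrans (clB _ _) (congr2 (fun a b => a - b) (clM _ _) (clM _ _)).
Qed.

Lemma class_pdesc k n :
  cl (pdesc X k n) = dyck_desc mul e (fun k i => cl (X k i)) k n.
Proof. by elim: n => [//|n IH]; rewrite clM IH. Qed.

Lemma class_dyck_half :
  dyck_half mul u e m (fun k => cl (D k)) (fun k i => cl (X k i)).
Proof.
have rel a b (ab : dyck_rel u X D a b) := cl_rel (dyckA ab).
split.
- move=> k; rewrite -clM; congr cl.
  exact: (@idem_arr R dyck_quiver (ArrDminus k)).
- move=> [|k]; rewrite -clM; congr cl; first exact: pa_mul0l.
  exact: (@arr_idem R dyck_quiver (ArrDminus k)).
- by move=> k; rewrite -clM eD.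
- by move=> k; rewrite -clM De.
- by move=> k i; rewrite -clM eX.
- by move=> k i; rewrite -clM Xe.
- by move=> k i i0 ik; rewrite -!clM; apply: rel; apply: D_braid.
- by move=> k i j ik jk ij; rewrite -!clM; apply: rel; apply: D_far.
- by move=> k i i0 ik; rewrite -!clM; apply: rel; apply: D_Tm; lia.
- by move=> k i ik; rewrite -!clM; apply: rel; apply: D_pT.
- by move=> k k1; rewrite -!class_pcomm -!clM -clZ; apply: rel; apply: D_comm_m.
- by move=> k k1; rewrite -!class_pcomm -!clM -clZ; apply: rel; apply: D_comm_p.
Qed.

End Half.

Hypothesis q_unit : q \is a GRing.unit.
Hypothesis q1_unit : q - 1 \is a GRing.unit.

Lemma pe_pe k : pe R k ** pe R k = pe R k.
Proof. by rewrite /pe idem_mul eqxx. Qed.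

Lemma pT_e k i : pT R k i ** pe R k = pT R k i.
Proof.
rewrite /pT; case: decP => h; last exact: pa_mul0l.
exact: (@arr_idem R dyck_quiver (ArrT h)).
Qed.

Lemma e_pT k i : pe R k ** pT R k i = pT R k i.
Proof.
rewrite /pT; case: decP => h; last exact: pa_mul0r.
exact: (@idem_arr R dyck_quiver (ArrT h)).
Qed.

Lemma pTinv_e k i : pTinv q k i ** pe R k = pTinv q k i.
Proof.
rewrite [LHS]pa_mulZl; congr (_ *: _).
rewrite [LHS]pa_mulDl; congr (_ + _); first exact: pT_e.
by rewrite [LHS]pa_mulZl; congr (_ *: _); apply: pe_pe.
Qed.

Lemma e_pTinv k i : pe R k ** pTinv q k i = pTinv q k i.
Proof.
rewrite [LHS]pa_mulZr; congr (_ *: _).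
rewrite [LHS]pa_mulDr; congr (_ + _); first exact: e_pT.
by rewrite [LHS]pa_mulZr; congr (_ *: _); apply: pe_pe.
Qed.

Hypothesis clTV : forall k i, (0 < i < k)%N ->
  mul (cl (pT R k i)) (cl (pTinv q k i)) = cl (pe R k).
Hypothesis clVT : forall k i, (0 < i < k)%N ->
  mul (cl (pTinv q k i)) (cl (pT R k i)) = cl (pe R k).

Lemma class_double_dyck :
  double_dyck mul q e m (fun k => cl (pdp R k)) (fun k => cl (pds R k))
    (fun k i => cl (pT R k i)) (fun k i => cl (pTinv q k i))
    (fun k => (q ^+ k.-1 * (q - 1))^-1) (fun k => q ^+ k / (1 - q))
    (fun k i => cl (py q k i)) (fun k i => cl (pz q k i)).
Proof.
split; [exact: mulP| | | |exact: clTV|exact: clVT|..].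
- apply: class_dyck_half => [a b ab|k|k|k i|k i].
  + exact: A_dyck.
  + exact: (@idem_arr R dyck_quiver (ArrDplus k)).
  + exact: (@arr_idem R dyck_quiver (ArrDplus k)).
  + exact: e_pT.
  + exact: pT_e.
- apply: class_dyck_half => [a b ab|k|k|k i|k i].
  + exact: A_dyck_star.
  + exact: (@idem_arr R dyck_quiver (ArrDplusStar k)).
  + exact: (@arr_idem R dyck_quiver (ArrDplusStar k)).
  + exact: e_pTinv.
  + exact: pTinv_e.
- by move=> k; rewrite -clM pe_pe.
- move=> k; apply: etrans (clZ _ _) (congr1 _ (etrans (clM _ _) _)).
  exact: congr2 (class_pcomm _ _) (class_pdesc _ _ _).
- move=> k [//|i] _.
  exact: etrans (clZ _ _)
    (congr1 _ (etrans (clM _ _) (congr1 (mul^~ _) (clM _ _)))).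
- move=> k; apply: etrans (clZ _ _) (congr1 _ (etrans (clM _ _) _)).
  exact: congr2 (class_pcomm _ _) (class_pdesc _ _ _).
- move=> k [//|i] _.
  exact: etrans (clZ _ _)
    (congr1 _ (etrans (clM _ _) (congr1 (mul^~ _) (clM _ _)))).
- move=> [|[|k]] // _ /=; have qk1_unit : q ^+ k * (q - 1) \is a GRing.unit.
    by rewrite unitrM unitrX.
  by rewrite exprS -(mulrA q) (invrM q_unit) // divrK.
- by move=> k k0; rewrite -2!clM; apply/cl_rel/A_sy.
Qed.

End PathAlgebraQuotient.

Lemma corner_idempotent (S : semigroupType) (e a : S) :
  (e * e = e -> e * (e * a * e) * e = e * a * e)%g.
Proof. by move=> ee; rewrite !mulgA ee -!mulgA ee. Qed.

Section AqtRepresentation.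
Variables (R : comUnitRingType) (q t : R).

Lemma Aqt_bilinear_assoc : bilinear_assoc (fun a b : Aqt q t => a ** b).
Proof.
split.
- exact: mulgA.
- exact: pq_mulDl.
- exact: pq_mulDr.
- exact: pq_mulZl.
- exact: pq_mulZr.
Qed.

Variables (s r : R) (k : nat).
Hypothesis s2 : s * s = q.
Hypothesis q_unit : q \is a GRing.unit.
Hypothesis q1_unit : q - 1 \is a GRing.unit.
Hypothesis k_gt0 : (0 < k)%N.

Fact corner_subproof (a : Aqt q t) :
  ae q t k ** (ae q t k ** a ** ae q t k) ** ae q t k ==
  ae q t k ** a ** ae q t k.
Proof. by apply/eqP/corner_idempotent/class_idem. Qed.

(** The compression [a |-> e_k a e_k] sends every element of the algebra to a
    loop and fixes the loops. *)
Definition Aqt_corner (a : Aqt q t) : Aqt_loops q t k :=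
  Loop (corner_subproof a).

Lemma Aqt_loop_representation :
  exists f : UMagmaMorphism.type (Bplus k) (Aqt_loops q t k),
    [/\ forall i, (0 < i < k)%N ->
          loop_val (f (BT k i)) = s^-1 *: aT q t k i,
        forall i, (0 < i <= k)%N -> loop_val (f (By k i)) = - ay q t k i
      & forall i, (0 < i <= k)%N -> loop_val (f (Bz k i)) = r *: az q t k i].
Proof.
have ddP := class_double_dyck Aqt_bilinear_assoc (@classM _ _ _) (@classB _ _ _)
  (@classZ _ _ _) (@class_rel _ _ _) q_unit q1_unit
  (fun k i ik => (aT_inv t q_unit ik).1) (fun k i ik => (aT_inv t q_unit ik).2).
have cornerK (a : Aqt q t) : ae q t k ** a = a -> a ** ae q t k = a ->
    loop_val (Aqt_corner a) = a.
  by move=> ea aE; apply: etrans (congr1 (fun b => b ** _) ea) aE.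
exact: (double_dyck_representation ddP q_unit r s2 k_gt0
  (val := fun a : Aqt_loops q t k => loop_val a) val_inj
  (fun _ _ => erefl) erefl cornerK).
Qed.

End AqtRepresentation.

(** * Specialization to the ground field with a square root of q *)

Lemma ext_q_unit : ext_q \is a GRing.unit.
Proof.
apply: (rmorph_unit (GRing.in_alg Qqt_sqrt)); rewrite unitfE.
by rewrite tofrac_eq0 polyC_eq0 polyX_eq0.
Qed.

Lemma ext_q1_unit : ext_q - 1 \is a GRing.unit.
Proof.
have -> : ext_q - 1 = GRing.in_alg Qqt_sqrt (Qqt_q - 1).
  by rewrite rmorphB rmorph1.
apply: rmorph_unit; rewrite unitfE /Qqt_q -tofrac1 -tofracB tofrac_eq0.
by rewrite -polyC1 -polyCB polyC_eq0 -[1]polyC1 polyXsubC_eq0.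
Qed.

Theorem proposition5p3 (k : nat) (hk : (1 <= k)%N) :
  exists f : UMagmaMorphism.type (Bplus k) (Aqt_loops ext_q ext_t k),
    [/\ forall i : nat, (1 <= i <= k.-1)%N ->
          loop_val (f (BT k i)) = sqrt_q^-1 *: aT ext_q ext_t k i,
        forall i : nat, (1 <= i <= k)%N ->
          loop_val (f (By k i)) = - ay ext_q ext_t k i
      & forall i : nat, (1 <= i <= k)%N ->
          loop_val (f (Bz k i)) = (ext_q * ext_t)^-1 *: az ext_q ext_t k i].
Proof.
have [f [fT fy fz]] := Aqt_loop_representation ext_t (ext_q * ext_t)^-1
  sqrt_qE ext_q_unit ext_q1_unit hk.
exists f; split=> [i ik|i ik|i ik]; [apply: fT; lia|exact: fy|exact: fz].
Qed.
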